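(* Let $Y_1,\ldots,Y_n$ be a martingale difference sequence with $-p_i\le Y_i\le 1-p_i$ for $i=1,\ldots,n$ and suitable constants $p_i\in(0,1)$. Set $p=\frac1n\sum_{i=1}^np_i$. Let $\mathcal{F}$ be the set of all functions $f:\mathbb{R}\to[0,+\infty)$ that are increasing and convex, and let $B_{n,p}$ be a binomial random variable of parameters $n$ and $p$. Then, for any real $t\in(0,1-p)$, $$\mathbb{P}\left[\sum_{i=1}^nY_i\ge nt\right]\le\inf_{f\in\mathcal{F}}\frac{1}{f(nt+np)}\,\mathbb{E}[f(B_{n,p})].$$ Furthermore, if $n(p+t)$ is a positive integer and $t$ satisfies $\frac{p(1-p)(e-1)}{1-p+ep}<t<1-p$, then $$\inf_{f\in\mathcal{F}}\frac{1}{f(nt+np)}\,\mathbb{E}[f(B_{n,p})]\le\frac{h+1}{e^h}\left\{H_m(n,p,t)-T(n,p,t)\right\}+\left(1-\frac{1+h}{e^h}\right)\mathbb{P}[B_{n,p}=n(p+t)],$$ where $$T(n,p,t):=\sum_{j\le n(p+t)-1}e^{h(j-n(p+t))}\,\mathbb{P}[B_{n,p}=j],$$ $$H_m(n,p,t):=\left\{\left(\frac{p}{p+t}\right)^{p+t}\left(\frac{1-p}{1-p-t}\right)^{1-p-t}\right\}^n,$$ and $h$ is the positive real satisfying $$e^{-hn(t+p)}\,\mathbb{E}\left[e^{hB_{n,p}}\right]=\inf_{s>0}e^{-(snt+snp)}\,\mathbb{E}\left[e^{sB_{n,p}}\right].$$ Moreover, the right-hand side of the second displayed inequality is less than $H_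m(n,p,t)$.
   Context: A sequence $Y_1,Y_2,\ldots$ of integrable random variables is a martingale difference sequence if $\mathbb{E}[Y_k\mid\mathcal{F}_{k-1}]=0$ for all $k\ge1$, where $\mathcal{F}_{k-1}$ is the $\sigma$-algebra generated by $Y_1,\ldots,Y_{k-1}$ and $\mathcal{F}_0$ is the trivial $\sigma$-algebra. ''Increasing'' means non-decreasing. In the infimum over $f\in\mathcal{F}$, only functions with $f(nt+np)>0$ are considered. The sum defining $T(n,p,t)$ runs over the integers $j$ with $0\le j\le n(p+t)-1$. *)

(* Defs.v *)
From HB Require Import structures.
From mathcomp Require Import all_boot all_order all_algebra.
From mathcomp Require Import all_classical all_reals all_analysis.

Set Implicit Arguments.
Unset Strict Implicit.
Unset Printing Implicit Defensive.

Import Order.TTheory GRing.Theory Num.Theory.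
Import numFieldNormedType.Exports.

Local Open Scope classical_set_scope.
Local Open Scope ring_scope.

Section conditional_expectation.
Context (R : realType) (d : measure_display) (T : measurableType d).
Variable P : probability T R.

Definition is_cond_expectation (G : set (set T)) (X Z : T -> R) : Prop :=
  [/\ forall A : set R, measurable A -> G (Z @^-1` A),
      P.-integrable [set: T] (EFin \o Z) &
      forall A : set T, G A ->
        (\int[P]_(w in A) (Z w)%:E = \int[P]_(w in A) (X w)%:E)%E].

Variables (n : nat) (Y : 'I_n -> {RV P >-> R}).

(* Indices start at 0: the variable Y_{k+1} of the usual numbering is [Y k], and
   [past k] is the sigma-algebra generated by the variables [Y j], j < k.
   In particular [past] is {set0, setT} at the first index. *)
Definition past (k : 'I_n) : set (set T) :=
  g_sigma_preimage
    (fun j : 'I_k => (Y (widen_ord (ltnW (ltn_ord k)) j) : T -> R)).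

Definition martingale_difference : Prop :=
  forall k : 'I_n, P.-integrable [set: T] (EFin \o Y k) /\
    is_cond_expectation (past k) (Y k) (cst 0).

End conditional_expectation.

Arguments martingale_difference {R d T} P {n} Y.

Definition increasing_convex (R : realType) : set (R -> R) :=
  [set f | [/\ forall x, 0 <= f x,
               {homo f : x y / x <= y} &
               convex_function [set: R^o] (f : R^o -> R^o)]].

Section binomial.
Context (R : realType) (d : measure_display) (T : measurableType d).
Variables (P : probability T R) (B : {RV P >-> nat}).

Definition has_binomial_law (n : nat) (p : R) : Prop :=
  forall A : set nat, distribution P B A = binomial_prob n p A.

Definition inf_increasing_convex (x : R) : \bar R :=
  ereal_inf [set (((f x)^-1)%:E * 'E_P[(fun w => f (B w)%:R)])%E
            | f in [set f | increasing_convex f /\ 0 < f x]].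

Definition optimal_exponent (n : nat) (p t h : R) : Prop :=
  0 < h /\
  ((expR (- (h * n%:R * (t + p))))%:E * 'E_P[(fun w => expR (h * (B w)%:R))]
   = ereal_inf
       [set (expR (- (s * n%:R * t + s * n%:R * p)))%:E
            * 'E_P[(fun w => expR (s * (B w)%:R))]
       | s in [set s : R | (0 < s)%R]])%E.

Definition prob_eq (x : R) : R := fine (P [set w | (B w)%:R = x]).

(* The range j < n.+1 loses no term: j <= n (p + t) - 1 forces j < n
   since p + t < 1. *)
Definition T_sum (n : nat) (p t h : R) : R :=
  \sum_(j < n.+1 | j%:R <= n%:R * (p + t) - 1)
    expR (h * (j%:R - n%:R * (p + t))) * prob_eq j%:R.

Definition H_m (n : nat) (p t : R) : R :=
  ((p / (p + t)) `^ (p + t) * ((1 - p) / (1 - p - t)) `^ (1 - p - t)) ^+ n.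

Definition improved_bound (n : nat) (p t h : R) : R :=
  (h + 1) / expR h * (H_m n p t - T_sum n p t h)
  + (1 - (1 + h) / expR h) * prob_eq (n%:R * (p + t)).

End binomial.

Arguments has_binomial_law {R d T} P B n p.
Arguments inf_increasing_convex {R d T} P B x.
Arguments optimal_exponent {R d T} P B n p t h.
Arguments prob_eq {R d T} P B x.
Arguments T_sum {R d T} P B n p t h.
Arguments improved_bound {R d T} P B n p t h.

(* Main.v *)
Require Import Defs.
From HB Require Import structures.
From mathcomp Require Import all_boot all_order all_algebra.
From mathcomp Require Import all_classical all_reals all_analysis.
From mathcomp Require Import measurable_realfun ring lra.

Import Order.TTheory GRing.Theory Num.Theory.
Import numFieldNormedType.Exports.

Local Open Scope classical_set_scope.
Local Open Scope ring_scope.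

(** Write [X_i = Y_i + q_i], so that [X_i] lies between 0 and 1 almost surely
    and has conditional mean [q_i] given the past, and let [S] be the sum of the
    [X_i].  The event of the theorem is [S >= nt + np], so that by Markov's
    inequality its probability is at most [E f(S) / f(nt + np)] for every
    nonnegative increasing [f].

    It remains to compare [E f(S)] with [E f(B)] for convex [f].  Between [s] and
    [s + 1] the graph of [f] lies below its chord; since the chord is affine,
    replacing [X_i] by a Bernoulli variable of mean [q_i] can only increase the
    expectation.  Averaging over that variable is the operator
    [bernoulli_shift q f s = (1 - q) f(s) + q f(s + 1)], which preserves the
    class of nonnegative increasing convex functions, so the replacement can be
    repeated from the last variable to the first
    ([expectation_sum_le_foldr]).  The outcome is the expectation of [f] at a
    sum of independent Bernoulli variables of parameters [q_i].  As in
    Hoeffding's work on such sums, it increases when two of the parameters are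
    moved towards each other with their sum fixed, because
    [f s - 2 f (s + 1) + f (s + 2) >= 0]; pushing all of them to
    their mean [p] gives the binomial law ([foldr_bernoulli_shift_le_mean],
    [iter_bernoulli_shiftE]).

    For the second part let [a = p + t] and [m = n a], an integer with
    [0 < m < n].  The function of [s] minimized by [h] is the [n]-th power of
    [chernoff p a s], whose only minimum is at the explicit
    [chernoff_exponent p a], with minimum value [H_m]; the lower bound on [t] says
    exactly that this exponent exceeds 1.  The exponential [e^(h (x - m))] is then
    replaced by its tangent at [m], cut off at 0: the function [hinge h m].  Because
    [h > 1], the hinge vanishes at the integers below [m]; it is 1 at [m]; and above
    [m] its ratio to the exponential is at most [(1 + h) / e^h], the ratio at
    [m + 1], because [(1 + y) e^(-y)] decreases for [y >= 0].  Summing these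
    bounds against the binomial weights gives the improved bound, and the
    comparison with the exponential itself is strict at [n] since
    [1 + h < e^h]. *)

(** * Bernoulli averaging of increasing convex functions *)

(** Frees convexity from the bundled unit-interval scalars, so that arithmetic
    decision procedures apply to it. *)
Lemma increasing_convexP {R : realType} (f : R -> R) : increasing_convex f <->
  [/\ forall x, 0 <= f x, {homo f : x y / x <= y} &
      forall x a b, 0 <= x <= 1 ->
        f (x * a + (1 - x) * b) <= x * f a + (1 - x) * f b].
Proof.
split=> -[f0 fi cf]; split => //.
  move=> x a b /andP[x0 x1].
  exact: (cf (Itv01 x0 x1) a b (in_setT _) (in_setT _)).
by move=> x a b _ _; apply: cf; rewrite ge0 le1.
Qed.

Section bernoulli_shift.
Context {R : realType}.
Implicit Types (f g : R -> R) (a b c p q s x : R) (l : seq R).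

(** The expectation of [f (s + X)] for a Bernoulli variable [X] of parameter [q]. *)
Definition bernoulli_shift q f : R -> R :=
  fun s => (1 - q) * f s + q * f (s + 1).

Lemma bernoulli_shift_increasing_convex q f : 0 <= q <= 1 ->
  increasing_convex f -> increasing_convex (bernoulli_shift q f).
Proof.
move=> q01 /increasing_convexP[f0 fi cf]; apply/increasing_convexP.
rewrite /bernoulli_shift; split => [x|x y xy|x a b x01].
- by have := f0 x; have := f0 (x + 1); nra.
- have := fi _ _ xy; have : f (x + 1) <= f (y + 1) by apply: fi; lra.
  by nra.
- have h1 := cf x a b x01; have := cf x (a + 1) (b + 1) x01.
  rewrite (_ : x * (a + 1) + _ = x * a + (1 - x) * b + 1); last by ring.
  by move: h1; nra.
Qed.

Lemma bernoulli_shiftC a b f :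
  bernoulli_shift a (bernoulli_shift b f) =
  bernoulli_shift b (bernoulli_shift a f).
Proof. by apply/funext => s; rewrite /bernoulli_shift; ring. Qed.

Lemma ler_bernoulli_shift q f g : 0 <= q <= 1 -> (forall s, f s <= g s) ->
  forall s, bernoulli_shift q f s <= bernoulli_shift q g s.
Proof.
move=> q01 fg s; rewrite /bernoulli_shift.
by have := fg s; have := fg (s + 1); nra.
Qed.

(** The composite of two shifts is [1 + (a + b) D + a b D^2], where [D] is the
    forward difference: at fixed [a + b] only the coefficient of [D^2 f], which is
    nonnegative by convexity, depends on the parameters. *)
Lemma bernoulli_shift2_le a b c d f s : increasing_convex f ->
  a + b = c + d -> a * b <= c * d ->
  bernoulli_shift a (bernoulli_shift b f) s <=
  bernoulli_shift c (bernoulli_shift d f) s.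
Proof.
move=> /increasing_convexP[_ _ cf] abcd ab_le.
have := cf 2^-1 s (s + 1 + 1).
rewrite (_ : 2^-1 * s + _ = s + 1); last by field.
move=> /(_ _)/wrap[]; first lra.
move=> cf2.
rewrite -subr_ge0 /bernoulli_shift.
rewrite (_ : _ - _ = (c * d - a * b) * (f s - 2 * f (s + 1) + f (s + 1 + 1)) +
  (c + d - a - b) * (f (s + 1) - f s)); last by ring.
rewrite (_ : c + d - a - b = 0) ?mul0r ?addr0; last by lra.
by apply: mulr_ge0; lra.
Qed.

Lemma foldr_bernoulli_shift_increasing_convex l f :
  {in l, forall q, 0 <= q <= 1} ->
  increasing_convex f -> increasing_convex (foldr bernoulli_shift f l).
Proof.
move=> l01 cf; elim: l l01 => //= q l ih l01.
apply: bernoulli_shift_increasing_convex; first by apply: l01; rewrite mem_head.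
by apply: ih => x xl; apply: l01; rewrite inE xl orbT.
Qed.

Lemma foldr_bernoulli_shift_rem a l f : a \in l ->
  foldr bernoulli_shift f l = bernoulli_shift a (foldr bernoulli_shift f (rem a l)).
Proof.
elim: l => //= b l ih; rewrite inE; case: eqVneq => [-> //|ab /= al].
by rewrite ih// bernoulli_shiftC; case: eqVneq ab.
Qed.

Lemma exists_le_mean l p : l != [::] -> \sum_(x <- l) x <= (size l)%:R * p ->
  exists2 x, x \in l & x <= p.
Proof.
elim: l => // x l ih _ /=; rewrite big_cons mulrS mulrDl mul1r => lp.
have [xp|px] := leP x p; first by exists x; rewrite ?mem_head.
case: l => [|y l] in ih lp *.
  by move: lp; rewrite big_nil mul0r; lra.
have [//||z zl zp] := ih; first lra.
by exists z => //; rewrite inE zl orbT.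
Qed.

Lemma exists_ge_mean l p : l != [::] -> (size l)%:R * p <= \sum_(x <- l) x ->
  exists2 x, x \in l & p <= x.
Proof.
move=> l0 lp; have [||x] := exists_le_mean (map -%R l) (- p).
- by case: l l0 lp.
- by rewrite big_map sumrN size_map mulrN lerN2.
- by case/mapP => y yl ->; rewrite lerN2; exists y.
Qed.

(** Each step takes one parameter [a <= p] and another one [b >= p], and replaces
    them by [p] and [a + b - p].  The sum is unchanged, the product increases by
    [(p - a) (b - p)], and since one parameter has become [p], the others still
    have mean [p]. *)
Lemma foldr_bernoulli_shift_le_mean l p f s : increasing_convex f ->
  {in l, forall q, 0 <= q <= 1} -> \sum_(q <- l) q = (size l)%:R * p ->
  foldr bernoulli_shift f l s <= iter (size l) (bernoulli_shift p) f s.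
Proof.
move=> cf.
have [k kl] := ubnP (size l); elim: k => // k ih in l s kl *.
have [-> //|l0] := eqVneq l [::] => l01 lp.
have [a al ap] : exists2 a, a \in l & a <= p.
  by apply: exists_le_mean => //; rewrite lp.
have /andP[a0 a1] := l01 _ al.
rewrite (foldr_bernoulli_shift_rem _ _ _ al).
have sl : size l = (size (rem a l)).+1 by rewrite size_rem// prednK// lt0n size_eq0.
have ral x : x \in rem a l -> 0 <= x <= 1 by move/mem_rem/l01.
have lpa : \sum_(q <- rem a l) q = (size (rem a l))%:R * p + (p - a).
  by move: lp; rewrite (perm_big _ (perm_to_rem al))/= big_cons sl mulrS; lra.
move: (rem a l) => l' in sl ral lpa *.
have [l'0|l'0] := eqVneq l' [::].
  move: lpa; rewrite sl l'0 big_nil /= mul0r add0r => pa.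
  by rewrite (_ : a = p)//; lra.
have [b bl pb] : exists2 b, b \in l' & p <= b.
  by apply: exists_ge_mean => //; rewrite lpa; lra.
have /andP[b0 b1] := ral _ bl.
rewrite (foldr_bernoulli_shift_rem _ _ _ bl).
have sl' : size l' = (size (rem b l')).+1.
  by rewrite size_rem// prednK// lt0n size_eq0.
have rbl x : x \in rem b l' -> 0 <= x <= 1 by move/mem_rem/ral.
have lpb : \sum_(q <- rem b l') q = (size (rem b l'))%:R * p + (p + p - a - b).
  move: lpa; rewrite (perm_big _ (perm_to_rem bl))/= big_cons sl' mulrS.
  by lra.
move: (rem b l') => m in sl' rbl lpb *.
have cg : increasing_convex (foldr bernoulli_shift f m).
  exact: foldr_bernoulli_shift_increasing_convex.
(* The pair [a, b] becomes [p, a + b - p]; the induction applies to the rest. *)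
apply: (le_trans (bernoulli_shift2_le a b p (a + b - p) _ s cg _ _)); first by ring.
  by nra.
rewrite sl iterS; apply: ler_bernoulli_shift => [|{}s]; first lra.
rewrite sl' -/(size (a + b - p :: m)).
apply: (ih (a + b - p :: m)).
- by rewrite /= -sl' -ltnS -sl.
- by move=> x; rewrite inE => /predU1P[->|/rbl//]; apply/andP; split; lra.
- by rewrite big_cons lpb /= mulrS; ring.
Qed.

Lemma binomial_pmfE n p k :
  binomial_pmf n p k = p ^+ k * (1 - p) ^+ (n - k) * 'C(n, k)%:R.
Proof. by rewrite mulr_natr. Qed.

(** Pascal's rule, read as: the sum of [n] independent Bernoulli variables of the
    same parameter is binomial. *)
Lemma iter_bernoulli_shiftE n p f s : iter n (bernoulli_shift p) f s =
  \sum_(k < n.+1) binomial_pmf n p k * f (s + k%:R).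
Proof.
elim: n s => [|n ih] s.
  by rewrite /= big_ord1 /binomial_pmf /= !expr0 bin0 !mul1r addr0.
rewrite iterS {1}/bernoulli_shift !ih.
pose F k := f (s + k%:R).
transitivity (\sum_(k < n.+2) (1 - p) * binomial_pmf n p k * F k +
   \sum_(k < n.+1) p * binomial_pmf n p k * F k.+1).
  congr (_ + _).
    rewrite [RHS]big_ord_recr /= [X in _ + _ * X * _](_ : _ = 0)
      ?mulr0 ?mul0r ?addr0; last first.
      by rewrite /binomial_pmf bin_small.
    by rewrite mulr_sumr; apply: eq_bigr => i _; rewrite mulrA.
  rewrite mulr_sumr; apply: eq_bigr => i _; rewrite -mulrA /F.
  by rewrite -addrA mulrS.
rewrite big_ord_recl [RHS]big_ord_recl /F /= -addrA; congr (_ + _).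
  by congr (_ * _); rewrite !binomial_pmfE !bin0 !subn0 !expr0 !mulr1 !mul1r exprS.
rewrite -big_split /=; apply: eq_bigr => i _.
rewrite /bump /= add1n -mulrDl; congr (_ * _).
rewrite !binomial_pmfE binS natrD subSS mulrDr !mulrA; congr (_ + _); last first.
  by rewrite exprS.
have [ni|ni] := ltnP i n.
  rewrite -(subnSK ni) [(1 - p) ^+ _.+1]exprS; congr (_ * _).
  by rewrite mulrA [p ^+ _ * _]mulrC.
by rewrite bin_small ?ltnS// !mulr0.
Qed.

End bernoulli_shift.

(** * Integrals determined by the events of a random variable *)

Section cond_exp.
Context {R : realType} {d : measure_display} {T : measurableType d}.
Variable P : probability T R.

Import HBNNSimple.

Lemma integral_mul_nnsfun_comp (W S : T -> R) (g : {nnsfun R >-> R}) :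
  measurable_fun setT W -> (forall w, 0 <= W w) -> measurable_fun setT S ->
  (\int[P]_w ((g (S w))%:E * (W w)%:E) =
   \sum_(r \in range g) (r%:E * \int[P]_(w in S @^-1` (g @^-1` [set r])) (W w)%:E))%E.
Proof.
move=> mW W0 mS.
have mSg r : measurable (S @^-1` (g @^-1` [set r])).
  by rewrite -[X in measurable X]setTI; exact: mS.
have mI r : measurable_fun setT (fun w => (\1_(g @^-1` [set r]) (S w) : R)%:E).
  by apply/measurable_EFinP/measurableT_comp => //; exact: measurable_indic.
have mWE : measurable_fun setT (EFin \o W) by exact/measurable_EFinP.
have I0 r x : (0 <= r%:E * (\1_(g @^-1` [set r]) x : R)%:E)%E.
  by rewrite -EFinM; exact: nnfun_muleindic_ge0.
transitivity (\int[P]_w (\sum_(r \in range g)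
    (r%:E * (\1_(g @^-1` [set r]) (S w))%:E * (W w)%:E)))%E.
  apply: eq_integral => w _; rewrite -ge0_mule_fsuml; last by move=> r; exact: I0.
  by congr (_ * _)%E; rewrite [in LHS]fimfunE -fsumEFin.
rewrite ge0_integral_fsum//; last 2 first.
- move=> r; apply: emeasurable_funM => //.
  by apply: emeasurable_funM.
- by move=> r w _; apply: mule_ge0; [exact: I0|rewrite lee_fin].
apply: eq_fsbigr => r; rewrite inE => -[x _ <-].
under eq_integral do rewrite -muleA.
rewrite ge0_integralZl//; last 3 first.
- by apply: emeasurable_funM.
- by move=> w _; rewrite mule_ge0// lee_fin.
- by rewrite lee_fin.
congr (_ * _)%E; rewrite [RHS]integral_mkcond.
apply: eq_integral => w _; rewrite muleC.
by rewrite epatch_indic.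
Qed.

(** The pull-out property of conditional expectations: [W] and [W'] have the same
    conditional expectation given [S].  For simple [g] this is linearity, and
    monotone convergence extends it to every nonnegative [g]. *)
Lemma eq_integral_mul_comp (W W' S : T -> R) (g : R -> R) :
  measurable_fun setT W -> (forall w, 0 <= W w) ->
  measurable_fun setT W' -> (forall w, 0 <= W' w) ->
  measurable_fun setT S -> measurable_fun setT g -> (forall x, 0 <= g x) ->
  (forall D : set R, measurable D ->
    \int[P]_(w in S @^-1` D) (W w)%:E = \int[P]_(w in S @^-1` D) (W' w)%:E)%E ->
  (\int[P]_w ((g (S w))%:E * (W w)%:E) = \int[P]_w ((g (S w))%:E * (W' w)%:E))%E.
Proof.
move=> mW W0 mW' W'0 mS mg g0 WW'.
have mgE : measurable_fun setT (EFin \o g) by exact/measurable_EFinP.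
pose h := nnsfun_approx measurableT mgE.
have hg x : EFin \o h ^~ x @ \oo --> (g x)%:E.
  by apply: (cvg_nnsfun_approx measurableT mgE) => // y _; rewrite lee_fin.
have lim_h (V : T -> R) : measurable_fun setT V -> (forall w, 0 <= V w) ->
    (\int[P]_w ((g (S w))%:E * (V w)%:E) =
     lim (\int[P]_w ((h n (S w))%:E * (V w)%:E) @[n --> \oo]))%E.
  move=> mV V0.
  rewrite -monotone_convergence//=.
  - apply: eq_integral => w _; apply/esym/cvg_lim => //.
    by apply: cvgeZr => //; exact: hg.
  - move=> n; apply: emeasurable_funM; apply/measurable_EFinP => //.
    exact: measurableT_comp.
  - by move=> n w _; apply: mule_ge0; rewrite lee_fin.
  - move=> w _ a b ab; rewrite lee_wpmul2r ?lee_fin//.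
    exact/lefP/nd_nnsfun_approx.
suff hW n : (\int[P]_w ((h n (S w))%:E * (W w)%:E) =
             \int[P]_w ((h n (S w))%:E * (W' w)%:E))%E.
  by rewrite !lim_h//; under eq_fun do rewrite hW.
rewrite !integral_mul_nnsfun_comp//; apply: eq_fsbigr => r _.
by rewrite WW'.
Qed.

End cond_exp.

(** * Replacement of bounded increments by Bernoulli variables *)

Section martingale.
Context {R : realType} {d : measure_display} {T : measurableType d}.
Variable P : probability T R.

Lemma integral_onem_eq (Z : T -> R) (q : R) (A : set T) :
  measurable A -> measurable_fun setT Z -> (forall w, 0 <= Z w <= 1) ->
  0 <= q <= 1 ->
  (\int[P]_(w in A) (Z w)%:E = \int[P]_(w in A) q%:E ->
   \int[P]_(w in A) (1 - Z w)%:E = \int[P]_(w in A) (1 - q)%:E)%E.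
Proof.
move=> mA mZ Z01 q01 Zq.
have mZA : measurable_fun A Z by exact: measurable_funTS.
suff : (\int[P]_(w in A) (1 - Z w)%:E + \int[P]_(w in A) (Z w)%:E =
        \int[P]_(w in A) (1 - q)%:E + \int[P]_(w in A) q%:E)%E.
  rewrite Zq => /(congr1 (fun x => x - \int[P]_(w in A) q%:E)%E).
  by rewrite !addeK// integral_cst// fin_numM// fin_num_measure.
rewrite -!ge0_integralD//; first by apply: eq_integral => w _; rewrite -!EFinD !subrK.
all: try by move=> w _; rewrite lee_fin; have := Z01 w; lra.
- by apply/measurable_EFinP; apply: measurable_funB.
- exact/measurable_EFinP.
Qed.

(** The chord bound [f (s + z) <= (1 - z) f s + z f (s + 1)] is affine in [z], so
    [Z] can be integrated out and leaves only its conditional mean [q]. *)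
Lemma expectation_increment_le (S Z : T -> R) (q : R) (f : R -> R) :
  measurable_fun setT S -> measurable_fun setT Z ->
  (forall w, 0 <= Z w <= 1) -> 0 <= q <= 1 ->
  (forall D : set R, measurable D ->
    \int[P]_(w in S @^-1` D) (Z w)%:E = \int[P]_(w in S @^-1` D) q%:E)%E ->
  increasing_convex f ->
  (\int[P]_w (f (S w + Z w))%:E <= \int[P]_w (bernoulli_shift q f (S w))%:E)%E.
Proof.
move=> mS mZ Z01 q01 Zq /increasing_convexP[f0 fi cf].
have mf : measurable_fun setT f by exact: nondecreasing_measurable.
pose f1 x := f (x + 1).
have mf1 : measurable_fun setT f1.
  by apply: nondecreasing_measurable => // x y xy; apply: fi; lra.
have mfS g : measurable_fun setT g -> measurable_fun [set: T] (fun w => (g (S w))%:E).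
  by move=> mg; apply/measurable_EFinP; exact: measurableT_comp.
have mZE : measurable_fun [set: T] (fun w => (Z w)%:E) by exact/measurable_EFinP.
have mZ' : measurable_fun [set: T] (fun w => 1 - Z w) by exact: measurable_funB.
have mZE' : measurable_fun [set: T] (fun w => (1 - Z w)%:E) by exact/measurable_EFinP.
apply: (@le_trans _ _
  (\int[P]_w ((f (S w))%:E * (1 - Z w)%:E + (f1 (S w))%:E * (Z w)%:E))%E).
  apply: ge0_le_integral => //.
  - by move=> w _; rewrite lee_fin.
  - by apply/measurable_EFinP; apply: measurableT_comp => //; exact: measurable_funD.
  - by apply: emeasurable_funD; apply: emeasurable_funM => //; exact: mfS.
  - move=> w _; rewrite -!EFinM -EFinD lee_fin.
    have := cf (1 - Z w) (S w) (S w + 1).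
    rewrite (_ : _ + (1 - (1 - Z w)) * (S w + 1) = S w + Z w); last by ring.
    rewrite (_ : 1 - (1 - Z w) = Z w); last by ring.
    rewrite /f1 [f (S w) * _]mulrC [_ * Z w]mulrC; apply.
    by have := Z01 w; lra.
rewrite ge0_integralD//; last 4 first.
- by move=> w _; rewrite -EFinM lee_fin; have := Z01 w; have := f0 (S w); nra.
- by apply: emeasurable_funM => //; exact: mfS.
- by move=> w _; rewrite -EFinM lee_fin; have := Z01 w; have := f0 (S w + 1); rewrite /f1; nra.
- by apply: emeasurable_funM => //; exact: mfS.
rewrite (@eq_integral_mul_comp _ _ _ P (fun w => 1 - Z w) (cst (1 - q)))//; last 3 first.
- by move=> w; have := Z01 w; lra.
- by move=> w /=; lra.
- move=> D mD; apply: integral_onem_eq => //; last exact: Zq.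
  by rewrite -[X in measurable X]setTI; exact: mS.
rewrite (@eq_integral_mul_comp _ _ _ P Z (cst q))//; last 3 first.
- by move=> w; have := Z01 w; lra.
- by move=> w /=; lra.
- by move=> x; exact: f0.
have mc (c : R) : measurable_fun [set: T] (fun=> c%:E) by exact: measurable_cst.
rewrite -ge0_integralD//.
- rewrite le_eqVlt; apply/orP; left; apply/eqP; apply: eq_integral => w _.
  by rewrite -!EFinM -EFinD /bernoulli_shift /f1 /= mulrC [f _ * q]mulrC.
- by move=> w _; rewrite -EFinM lee_fin /=; have := f0 (S w); nra.
- by apply: emeasurable_funM; [exact: mfS|exact: mc].
- by move=> w _; rewrite -EFinM lee_fin /=; have := f0 (S w + 1); rewrite /f1; nra.
- by apply: emeasurable_funM; [exact: mfS|exact: mc].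
Qed.

(** The last increment is replaced first: what remains is the expectation of
    another increasing convex function at a shorter sum. *)
Lemma expectation_sum_le_foldr (k : nat) (Z : nat -> T -> R) (q : nat -> R)
    (f : R -> R) :
  (forall i, measurable_fun setT (Z i)) -> (forall i w, 0 <= Z i w <= 1) ->
  (forall i, (i < k)%N -> 0 <= q i <= 1) ->
  (forall i (D : set R), (i < k)%N -> measurable D ->
    let A := (fun w => \sum_(j < i) Z j w) @^-1` D in
    (\int[P]_(w in A) (Z i w)%:E = \int[P]_(w in A) (q i)%:E)%E) ->
  increasing_convex f ->
  (\int[P]_w (f (\sum_(i < k) Z i w)%R)%:E <=
   (foldr bernoulli_shift f [seq q i | i <- iota 0 k] 0)%:E)%E.
Proof.
move=> mZ Z01; elim: k f => [|k ih] f q01 Zq cf.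
  under eq_integral do rewrite big_ord0.
  by rewrite integral_cst//= probability_setT mule1.
under eq_integral do rewrite big_ord_recr/=.
have qk : 0 <= q k <= 1 by exact: q01.
apply: (le_trans (expectation_increment_le _ (Z k) (q k) f _ _ _ _ _ _)) => //.
- exact: measurable_sum.
- by move=> D mD; exact: Zq.
rewrite -addn1 iotaD map_cat foldr_cat add0n /=.
apply: ih.
- by move=> i ik; apply: q01; exact: ltnW.
- by move=> i D ik mD; apply: Zq => //; exact: ltnW.
- exact: bernoulli_shift_increasing_convex.
Qed.

End martingale.

Section bounded_martingale.
Context {R : realType}.

(** The bounds on the increments hold only almost surely.  Clamping makes them
    hold everywhere, changes nothing almost surely, and keeps an increment a
    function of the same [Y], hence measurable for the same past. *)
Definition clamp01 (x : R) : R := Num.max 0 (Num.min 1 x).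

Lemma clamp01_itv x : 0 <= clamp01 x <= 1.
Proof. by rewrite /clamp01 le_max lexx/= ge_max ler01 ge_min lexx. Qed.

Lemma clamp01_id x : 0 <= x <= 1 -> clamp01 x = x.
Proof. by case/andP=> x0 x1; rewrite /clamp01 (min_idPr x1) (max_idPr x0). Qed.

Lemma measurable_clamp01D c : measurable_fun setT (fun x : R => clamp01 (x + c)).
Proof.
apply: nondecreasing_measurable => // x y xy.
rewrite /clamp01 ge_max !le_max lexx /= orbC; apply/orP; left.
by rewrite le_min !ge_min lexx lerD2r xy orbT.
Qed.

Context {d : measure_display} {T : measurableType d}.
Variables (P : probability T R) (n : nat) (Y : 'I_n -> {RV P >-> R}).

(** A sum of functions of the earlier variables is measurable for the
    sigma-algebra that they generate, so the martingale property can be tested on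
    the events that it determines. *)
Lemma past_preimage_sum (k : 'I_n) (c : 'I_k -> R -> R) (D : set R) :
  (forall j, measurable_fun setT (c j)) -> measurable D ->
  past Y k ((fun w => \sum_(j < k) c j (Y (widen_ord (ltnW (ltn_ord k)) j) w)) @^-1` D).
Proof.
move=> mc mD.
set G := \big[setU/set0]_(j < k) preimage_set_system setT
  (Y (widen_ord (ltnW (ltn_ord k)) j) : T -> R) measurable.
have mX : measurable_fun [set: g_sigma_algebraType G]
   (fun w : T => \sum_(j < k) c j (Y (widen_ord (ltnW (ltn_ord k)) j) w)).
  apply: measurable_sum => j; apply: measurableT_comp => // _ C mC.
  apply: sub_sigma_algebra; rewrite /G (bigD1 j)//=; left.
  by exists C.
by have := mX measurableT D mD; rewrite setTI.
Qed.

Lemma expectation_clamped_sum_le (q : 'I_n -> R) (p : R) (f : R -> R) :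
  (forall i, 0 <= q i <= 1) -> martingale_difference P Y ->
  (forall i, {ae P, forall w, - q i <= Y i w <= 1 - q i}) ->
  \sum_(i < n) q i = n%:R * p -> increasing_convex f ->
  (\int[P]_w (f (\sum_(i < n) clamp01 (Y i w + q i))%R)%:E <=
   (iter n (bernoulli_shift p) f 0)%:E)%E.
Proof.
move=> q01 mdY bdY qp cf.
(* Sequences indexed by all naturals, zero from [n] on, so that the partial sums
   have no index casts. *)
pose Z i w := if insub i is Some j then clamp01 (Y j w + q j) else 0.
pose r i := if insub i is Some j then q j else 0.
have ZE (i : 'I_n) w : Z i w = clamp01 (Y i w + q i) by rewrite /Z valK.
have rE (i : 'I_n) : r i = q i by rewrite /r valK.
have mZ i : measurable_fun setT (Z i).
  rewrite /Z; case: insub => [j|]; last exact: measurable_cst.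
  by apply: (@measurableT_comp _ _ _ _ _ _ _ _ (Y j) (measurable_clamp01D (q j))).
have Z01 i w : 0 <= Z i w <= 1.
  by rewrite /Z; case: insub => [j|]; [exact: clamp01_itv|rewrite lexx ler01].
under eq_integral do under eq_bigr do rewrite -ZE.
have r01 i : 0 <= r i <= 1.
  by rewrite /r; case: insub => [j|]; [exact: q01|rewrite lexx ler01].
apply: (le_trans (expectation_sum_le_foldr P _ _ r _ mZ Z01 _ _ cf)) => //.
- move=> i D iltn mD A.
  pose k := Ordinal iltn.
  have pastA : past Y k A.
    pose w_ord := widen_ord (ltnW (ltn_ord k)).
    have := @past_preimage_sum k (fun j x => clamp01 (x + q (w_ord j))) D.
    move=> /(_ (fun j => measurable_clamp01D (q (w_ord j))) mD); congr (past Y k).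
    apply: (congr1 (fun X : T -> R => X @^-1` D)); apply/funext => w.
    by apply: eq_bigr => j _; rewrite -ZE.
  have mA : measurable A.
    have mS : measurable_fun setT (fun w => \sum_(j < i) Z j w).
      exact: measurable_sum.
    by rewrite -[A]setTI; exact: mS.
  have [iY [_ _ /(_ A pastA)]] := mdY k.
  rewrite integral0_eq// => Y0.
  transitivity (\int[P]_(w in A) ((Y k w)%:E + (q k)%:E))%E.
    apply: ae_eq_integral => //.
    - by apply/measurable_EFinP; exact: measurable_funTS.
    - by apply: emeasurable_funD => //; apply/measurable_EFinP; exact: measurable_funTS.
    have := bdY k; apply: filterS => w Yw _.
    by rewrite (ZE k) clamp01_id ?EFinD//; move: Yw; lra.
  rewrite (integralD_EFin mA (f1 := Y k) (f2 := cst (q k))).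
  - by rewrite -Y0 add0e /= (rE k).
  - exact: (integrableS measurableT).
  - exact: finite_measure_integrable_cst.
have -> : [seq r i | i <- iota 0 n] = [seq q i | i : 'I_n].
  by rewrite -val_enum_ord -map_comp; apply: eq_map => i; exact: rE.
rewrite lee_fin; set l := [seq _ | _ : _].
have sl : size l = n by rewrite size_map -cardE card_ord.
rewrite -sl; apply: foldr_bernoulli_shift_le_mean => //.
- by move=> x /mapP[i _ ->].
- by rewrite sl -qp big_map -big_enum.
Qed.

(** Markov's inequality for [f] of the clamped sum, which almost surely is the sum
    of the [Y i] shifted by [n p]. *)
Lemma martingale_tail_le (q : 'I_n -> R) (p t : R) (f : R -> R) :
  (forall i, 0 <= q i <= 1) -> martingale_difference P Y ->
  (forall i, {ae P, forall w, - q i <= Y i w <= 1 - q i}) ->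
  \sum_(i < n) q i = n%:R * p -> increasing_convex f ->
  ((f (n%:R * t + n%:R * p))%:E *
    P [set w | (n%:R * t <= \sum_(i < n) Y i w)%R] <=
   (iter n (bernoulli_shift p) f 0)%:E)%E.
Proof.
move=> q01 mdY bdY qp cf.
apply: le_trans (expectation_clamped_sum_le q p f q01 mdY bdY qp cf).
have /increasing_convexP[f0 fi _] := cf.
set A := [set w | _].
have mSY : measurable_fun setT (fun w => \sum_(i < n) Y i w) by exact: measurable_sum.
have mA : measurable A.
  rewrite -[A]setTI (_ : A = (fun w => \sum_(i < n) Y i w) @^-1` `[n%:R * t, +oo[).
    by apply: mSY.
  by apply/seteqP; split => w /=; rewrite in_itv/= andbT.
rewrite -[A in P A]setIT -integral_indic// -ge0_integralZl//; last 2 first.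
- by apply/measurable_EFinP; exact: measurable_indic.
- by rewrite lee_fin.
apply: ae_ge0_le_integral => //.
- by move=> w _; apply: mule_ge0; rewrite lee_fin.
- by apply: emeasurable_funM => //; apply/measurable_EFinP; exact: measurable_indic.
- by move=> w _; rewrite lee_fin.
- apply/measurable_EFinP; apply: measurableT_comp.
    exact: nondecreasing_measurable.
  apply: measurable_sum => i.
  by apply: (@measurableT_comp _ _ _ _ _ _ _ _ (Y i) (measurable_clamp01D (q i))).
have : {ae P, forall w, forall i, - q i <= Y i w <= 1 - q i}.
  exact: filter_forall.
apply: filterS => w Yw _.
rewrite -EFinM lee_fin indicE; case: (boolP (w \in A)) => wA; last by rewrite mulr0.
rewrite mulr1; apply: fi.
rewrite (eq_bigr (fun i => Y i w + q i)) => [|i _].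
  by rewrite big_split/= qp lerD2r; move: wA; rewrite inE.
by rewrite clamp01_id//; have := Yw i; lra.
Qed.

End bounded_martingale.

(** * Expectations under the binomial law *)

Section binomial_law.
Context {R : realType} {d : measure_display} {T : measurableType d}.
Variables (P : probability T R) (B : {RV P >-> nat}) (n : nat) (p : R).
Hypotheses (p01 : 0 <= p <= 1) (lawB : has_binomial_law P B n p).

Lemma expectation_binomial (f : R -> R) : (forall x, 0 <= f x) ->
  'E_P[(fun w => f (B w)%:R)]%E = (\sum_(k < n.+1) binomial_pmf n p k * f k%:R)%:E.
Proof.
move=> f0; have /andP[p0 p1] := p01.
rewrite unlock.
have /= <- := @ge0_integral_distribution _ _ _ _ _ P B (fun k => (f k%:R)%:E).
- rewrite (@eq_measure_integral _ _ _ _ (binomial_prob n p)); last by move=> A _ _; exact: lawB.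
  rewrite (@integral_binomial _ n p p0 p1); last by move=> k; rewrite lee_fin.
  by rewrite -sumEFin; apply: eq_bigr => k _.
- by [].
- by move=> k; rewrite lee_fin.
Qed.

Lemma prob_eq_binomial (k : nat) : prob_eq P B k%:R = binomial_pmf n p k.
Proof.
rewrite /prob_eq (_ : [set w | _] = B @^-1` [set k]); last first.
  by apply/seteqP; split => w /= => [/eqP|->//]; rewrite eqr_nat => /eqP.
rewrite -[P _]/(distribution P B [set k]) lawB /binomial_prob p01.
by rewrite esum_set1// lee_fin binomial_pmf_ge0.
Qed.

Lemma binomial_expectation_iter (f : R -> R) : (forall x, 0 <= f x) ->
  'E_P[(fun w => f (B w)%:R)]%E = (iter n (bernoulli_shift p) f 0)%:E.
Proof.
move=> f0; rewrite expectation_binomial// iter_bernoulli_shiftE.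
by congr EFin; apply: eq_bigr => k _; rewrite add0r.
Qed.

End binomial_law.

(** * The optimal exponent *)

Section chernoff.
Context {R : realType}.
Implicit Types (p a t h s x y : R) (n m : nat).

(** The exponential moment of a single Bernoulli variable recentred at [a], that is
    [E e^(s (X - a))] for [X] Bernoulli of parameter [p]. *)
Definition chernoff p a s : R := expR (- (s * a)) * (1 - p + p * expR s).

Definition chernoff_exponent p a : R := ln (a * (1 - p) / (p * (1 - a))).

Lemma expR_chernoff_exponent p a : 0 < p < 1 -> 0 < a < 1 ->
  expR (chernoff_exponent p a) = a * (1 - p) / (p * (1 - a)).
Proof.
move=> /andP[p0 p1] /andP[a0 a1].
by rewrite lnK// posrE divr_gt0// mulr_gt0// subr_gt0.
Qed.

(** At the exponent [h] the tilted Bernoulli law, of weights proportional to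
    [1 - p] and [p e^h], has mean [a]; the second factor is the centred moment
    [E e^((s - h) (X - a))] under that law. *)
Lemma chernoffE p a s (h := chernoff_exponent p a) : 0 < p < 1 -> 0 < a < 1 ->
  chernoff p a s = chernoff p a h *
    ((1 - a) * expR (- ((s - h) * a)) + a * expR ((s - h) * (1 - a))).
Proof.
move=> p01 a01.
have Eh : p * expR h * (1 - a) = a * (1 - p).
  by rewrite expR_chernoff_exponent//; field; rewrite ?gt_eqF//; lra.
rewrite /chernoff.
rewrite (_ : - (s * a) = - (h * a) + - ((s - h) * a)); last by ring.
rewrite (_ : expR s = expR h * expR (s - h)); last by rewrite -expRD addrC subrK.
rewrite (_ : (s - h) * (1 - a) = (s - h) + - ((s - h) * a)); last by ring.
rewrite !(expRD _ (- ((s - h) * a))); set u := expR (- ((s - h) * a)).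
set v := expR (s - h); set w := expR (- (h * a)); set e := expR h in Eh *.
apply: subr0_eq.
transitivity (w * u * (1 - v) * (a * (1 - p) - p * e * (1 - a))); first by ring.
by rewrite Eh subrr mulr0.
Qed.

Lemma chernoff_gt0 p a s : 0 < p < 1 -> 0 < chernoff p a s.
Proof. by move=> p01; rewrite mulr_gt0 ?expR_gt0//; have := expR_gt0 s; nra. Qed.

(** [1 + x < expR x] for [x != 0], averaged over a centred Bernoulli variable of
    mean [a]: the linear terms cancel. *)
Lemma chernoff_lt p a s : 0 < p < 1 -> 0 < a < 1 ->
  s != chernoff_exponent p a ->
  chernoff p a (chernoff_exponent p a) < chernoff p a s.
Proof.
move=> p01 a01 sh; rewrite (chernoffE _ _ s)//; set h := chernoff_exponent p a in sh *.
rewrite ltr_pMr ?chernoff_gt0//.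
have x0 : s - h != 0 by rewrite subr_eq0.
move: (s - h) x0 => x x0 {sh}.
have xa : - (x * a) != 0 by rewrite oppr_eq0 mulf_neq0// gt_eqF//; lra.
have := expR_gt1Dx xa; have := expR_ge1Dx (x * (1 - a)).
by nra.
Qed.

(** This is where the lower bound on [t] comes from: after clearing denominators
    it is the inequality [e < e^h]. *)
Lemma chernoff_exponent_gt1 p t : 0 < p < 1 -> 0 < p + t < 1 ->
  p * (1 - p) * (expR 1 - 1) / (1 - p + expR 1 * p) < t ->
  1 < chernoff_exponent p (p + t).
Proof.
move=> p01 a01; have e0 := expR_gt0 (1 : R).
rewrite ltr_pdivrMr; last by nra.
move=> pt; rewrite -ltr_expR expR_chernoff_exponent//.
rewrite ltr_pdivlMr; last by apply: mulr_gt0; lra.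
by lra.
Qed.

Lemma chernoff_H_m n p t : 0 < p < 1 -> 0 < p + t < 1 ->
  chernoff p (p + t) (chernoff_exponent p (p + t)) ^+ n = H_m n p t.
Proof.
move=> p01 a01; rewrite /H_m; congr (_ ^+ _).
rewrite /chernoff expR_chernoff_exponent//.
rewrite -[1 - p - t]addrA -opprD; move: (p + t) a01 => a /andP[a0 a1].
have /andP[p0 p1] := p01.
have pa : 0 < p / a by rewrite divr_gt0.
have pa' : 0 < (1 - p) / (1 - a) by rewrite divr_gt0// subr_gt0.
rewrite (_ : 1 - p + _ = (1 - p) / (1 - a)); last first.
  by field; rewrite ?gt_eqF//; lra.
rewrite (_ : chernoff_exponent p a = ln ((1 - p) / (1 - a)) - ln (p / a)); last first.
  rewrite -ln_div// /chernoff_exponent; congr (ln _).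
  by field; rewrite ?gt_eqF//; lra.
rewrite /powR !gt_eqF//.
rewrite -{2}(lnK (x := (1 - p) / (1 - a))) ?posrE// -!expRD; congr expR.
by ring.
Qed.

Lemma iter_bernoulli_shift_expR n p s x :
  iter n (bernoulli_shift p) (fun y => expR (s * y)) x =
  (1 - p + p * expR s) ^+ n * expR (s * x).
Proof.
elim: n x => [|n ih] x; first by rewrite expr0 mul1r.
rewrite iterS /bernoulli_shift !ih mulrDr mulr1 expRD exprS.
by ring.
Qed.

Lemma chernoff_expectation d (T : measurableType d) (P : probability T R)
    (B : {RV P >-> nat}) n p a s : 0 <= p <= 1 -> has_binomial_law P B n p ->
  ((expR (- (s * n%:R * a)))%:E * 'E_P[(fun w => expR (s * (B w)%:R))] =
   (chernoff p a s ^+ n)%:E)%E.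
Proof.
move=> p01 lawB.
rewrite (@binomial_expectation_iter _ _ _ P B n p p01 lawB (fun y => expR (s * y))); last first.
  by move=> x; exact: expR_ge0.
rewrite iter_bernoulli_shift_expR mulr0 expR0 mulr1 -EFinM; congr EFin.
by rewrite /chernoff exprMn -expRM_natl; congr (expR _ * _); ring.
Qed.

Lemma optimal_exponentE d (T : measurableType d) (P : probability T R)
    (B : {RV P >-> nat}) n p t h : 0 <= p <= 1 -> has_binomial_law P B n p ->
  optimal_exponent P B n p t h <->
  0 < h /\ forall s, 0 < s ->
    chernoff p (p + t) h ^+ n <= chernoff p (p + t) s ^+ n.
Proof.
move=> p01 lawB; rewrite /optimal_exponent [t + p]addrC (chernoff_expectation _ _ _ _ _ _ _ _ p01)//.
have E s : ((expR (- (s * n%:R * t + s * n%:R * p)))%:E *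
    'E_P[(fun w => expR (s * (B w)%:R))] = (chernoff p (p + t) s ^+ n)%:E)%E.
  by rewrite -mulrDr [t + p]addrC (chernoff_expectation _ _ _ _ _ _ _ _ p01).
split=> -[h0 hmin]; split => //.
  move=> s s0; rewrite -lee_fin hmin.
  by apply: ereal_inf_lbound; exists s => //=; rewrite E.
apply/eqP; rewrite eq_le; apply/andP; split.
  by apply: le_ereal_inf_tmp => _ [s /= s0 <-]; rewrite E lee_fin hmin.
by apply: ereal_inf_lbound; exists h => //=; rewrite E.
Qed.

Lemma unique_optimal_exponent d (T : measurableType d) (P : probability T R)
    (B : {RV P >-> nat}) n p t : 0 < p < 1 -> 0 < p + t < 1 -> (0 < n)%N ->
  has_binomial_law P B n p -> 0 < chernoff_exponent p (p + t) ->
  unique (optimal_exponent P B n p t) (chernoff_exponent p (p + t)).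
Proof.
move=> p01 a01 n0 lawB h0.
have p01' : 0 <= p <= 1 by lra.
have lt_pow s : s != chernoff_exponent p (p + t) ->
    chernoff p (p + t) (chernoff_exponent p (p + t)) ^+ n <
    chernoff p (p + t) s ^+ n.
  move=> sh; rewrite ltr_pXn2r ?nnegrE ?ltW ?chernoff_gt0//.
  by rewrite chernoff_lt.
split.
  apply/optimal_exponentE => //; split => // s s0.
  by have [->//|/lt_pow/ltW] := eqVneq s (chernoff_exponent p (p + t)).
move=> h' /(optimal_exponentE _ _ _ _ _ _ _ _ p01' lawB)[h'0 /(_ _ h0) h'_le].
apply/eqP; rewrite eq_sym; apply/negPn/negP => /lt_pow.
by rewrite ltNge h'_le.
Qed.

End chernoff.

(** * The hinge function and the improved bound *)

Section hinge.
Context {R : realType}.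
Implicit Types (h m x y : R).

Definition hinge h m : R -> R := fun x => Num.max 0 (1 + h * (x - m)).

Lemma hinge_increasing_convex h m : 0 < h -> increasing_convex (hinge h m).
Proof.
move=> h0; apply/increasing_convexP; rewrite /hinge; split.
- by move=> x; rewrite le_max lexx.
- move=> x y xy; rewrite ge_max !le_max lexx /=; apply/orP; right.
  by nra.
- move=> x a b x01; rewrite ge_max.
  set u := Num.max _ (1 + h * (a - m)); set v := Num.max _ (1 + h * (b - m)).
  have u0 : 0 <= u by rewrite le_max lexx.
  have v0 : 0 <= v by rewrite le_max lexx.
  have ua : 1 + h * (a - m) <= u by rewrite le_max lexx orbT.
  have vb : 1 + h * (b - m) <= v by rewrite le_max lexx orbT.
  apply/andP; split; first by nra.
  rewrite (_ : 1 + _ = x * (1 + h * (a - m)) + (1 - x) * (1 + h * (b - m))).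
    by nra.
  by ring.
Qed.

(** The monotonicity of [(1 + y) e^(-y)] between [h] and [y]. *)
Lemma add1_le_expR h y : 0 < h -> h <= y ->
  1 + y <= (h + 1) / expR h * expR y.
Proof.
move=> h0 hy; rewrite -mulrA [_^-1 * _]mulrC -expRN -expRD.
apply: (@le_trans _ _ ((h + 1) * (1 + (y - h)))); first by nra.
by rewrite ler_wpM2l ?expR_ge1Dx//; lra.
Qed.

Lemma add1_div_expR_lt1 h : 0 < h -> (h + 1) / expR h < 1.
Proof.
by move=> h0; rewrite ltr_pdivrMr ?expR_gt0// mul1r addrC expR_gt1Dx// gt_eqF.
Qed.

End hinge.

Section improved_bound.
Context {R : realType} {d : measure_display} {T : measurableType d}.
Variables (P : probability T R) (B : {RV P >-> nat}) (n m : nat) (p t : R).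
Hypotheses (p01 : 0 < p < 1) (lawB : has_binomial_law P B n p).
Hypotheses (at01 : 0 < p + t < 1) (mE : n%:R * (p + t) = m%:R).
Let h := chernoff_exponent p (p + t).
Let c := (h + 1) / expR h.

Let p01' : 0 <= p <= 1. Proof. by case/andP: p01 => /ltW-> /ltW->. Qed.

(** The function whose expectation at the binomial law is the improved bound. *)
Definition bound_weight (k : nat) : R :=
  if (k < m)%N then 0 else if k == m then 1 else c * expR (h * (k%:R - m%:R)).

Lemma H_m_sum : H_m n p t =
  \sum_(k < n.+1) binomial_pmf n p k * expR (h * (k%:R - m%:R)).
Proof.
rewrite -chernoff_H_m//; apply: EFin_inj; rewrite -/h.
rewrite -(chernoff_expectation _ _ P B n p (p + t) h p01' lawB).
rewrite (expectation_binomial P B n p p01' lawB (fun x => expR (h * x))); last first.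
  by move=> x; exact: expR_ge0.
rewrite -EFinM mulr_sumr; congr EFin; apply: eq_bigr => k _.
rewrite mulrCA -expRD -mulrA mE; congr (_ * expR _); ring.
Qed.

Lemma T_sumE : T_sum P B n p t h = \sum_(k < n.+1) binomial_pmf n p k *
  (if (k < m)%N then expR (h * (k%:R - m%:R)) else 0).
Proof.
rewrite /T_sum big_mkcond/=; apply: eq_bigr => k _.
rewrite mE lerBrDr natr1 ler_nat; case: ifP => _; last by rewrite mulr0.
by rewrite (prob_eq_binomial P B n p)// mulrC.
Qed.

Lemma improved_boundE : (m <= n)%N -> improved_bound P B n p t h =
  \sum_(k < n.+1) binomial_pmf n p k * bound_weight k.
Proof.
move=> mn; rewrite /improved_bound H_m_sum T_sumE mE (prob_eq_binomial P B n p)//.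
rewrite [1 + h]addrC -/c.
have -> : binomial_pmf n p m = \sum_(k < n.+1) binomial_pmf n p k * ((k : nat) == m)%:R.
  have mn' : (m < n.+1)%N by [].
  rewrite (bigD1 (Ordinal mn'))//= eqxx mulr1 big1 ?addr0// => k.
  by rewrite -val_eqE/= => /negPf->; rewrite mulr0.
rewrite -sumrB !mulr_sumr -big_split/=; apply: eq_bigr => k _.
rewrite /bound_weight; case: ltngtP => [_|_|->] /=.
- ring.
- ring.
- by rewrite subrr mulr0 expR0; ring.
Qed.

Lemma hinge_le_bound_weight k : 1 < h -> hinge h m%:R k%:R <= bound_weight k.
Proof.
move=> h1; have h0 : 0 < h by lra.
rewrite /hinge /bound_weight ge_max; case: ltngtP => [km|mk|->].
- rewrite lexx /=; have : k%:R + 1 <= m%:R :> R by rewrite natr1 ler_nat.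
  by nra.
- have km : m%:R + 1 <= k%:R :> R by rewrite natr1 ler_nat.
  have := add1_le_expR _ (h * (k%:R - m%:R)) h0.
  move=> /(_ _)/wrap[]; first by nra.
  by rewrite -/c => H; apply/andP; split => //; apply: le_trans H; nra.
- by rewrite ler01 subrr mulr0 addr0 lexx.
Qed.

Lemma inf_increasing_convex_le_improved_bound : (m <= n)%N -> 1 < h ->
  (inf_increasing_convex P B m%:R <= (improved_bound P B n p t h)%:E)%E.
Proof.
move=> mn h1; have h0 : 0 < h by lra.
have cvx := hinge_increasing_convex h m%:R h0.
have hm : hinge h m%:R m%:R = 1.
  by rewrite /hinge subrr mulr0 addr0; apply/max_idPr; exact: ler01.
apply: ge_ereal_inf; exists ('E_P[(fun w => hinge h m%:R (B w)%:R)])%E.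
  exists (hinge h m%:R); first by split; rewrite //= hm.
  by rewrite hm invr1 mul1e.
have [f0 _ _] := cvx.
rewrite (expectation_binomial P B n p p01' lawB)// lee_fin improved_boundE//.
apply: ler_sum => k _; apply: ler_wpM2l; last exact: hinge_le_bound_weight.
exact: binomial_pmf_ge0.
Qed.

(** The improved bound and [H_m] integrate [bound_weight] and [e^(h (k - m))], and
    these differ at [k = n], a value of positive probability above [m]. *)
Lemma improved_bound_lt_H_m : (m < n)%N -> 0 < h ->
  improved_bound P B n p t h < H_m n p t.
Proof.
move=> mn h0; rewrite (improved_boundE (ltnW mn)).
rewrite H_m_sum big_ord_recr [X in _ < X]big_ord_recr /=.
have c1 : c < 1 := add1_div_expR_lt1 h h0.
have le_w k : bound_weight k <= expR (h * (k%:R - m%:R)).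
  have e0 := expR_gt0 (h * (k%:R - m%:R)).
  rewrite /bound_weight; case: ltngtP => [_|_|->]; first exact: ltW.
  - by nra.
  - by rewrite subrr mulr0 expR0.
apply: ler_ltD.
  by apply: ler_sum => k _; apply: ler_wpM2l; [exact: binomial_pmf_ge0|exact: le_w].
rewrite ltr_pM2l; last first.
  by rewrite binomial_pmfE subnn expr0 binn !mulr1 exprn_gt0//; case/andP: p01.
rewrite /bound_weight ltnNge ltnW//= gtn_eqF//.
by have := expR_gt0 (h * (n%:R - m%:R)); nra.
Qed.

End improved_bound.

(** * Tail bounds for bounded martingale differences *)

Theorem theorem1p10 (R : realType)
    (d : measure_display) (T : measurableType d) (P : probability T R)
    (n : nat) (n_gt0 : (0 < n)%N)
    (Y : 'I_n -> {RV P >-> R}) (q : 'I_n -> R)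
    (q01 : forall i, 0 < q i < 1)
    (mdY : martingale_difference P Y)
    (bdY : forall i, {ae P, forall w, - q i <= Y i w <= 1 - q i})
    (p : R) (pE : p = n%:R^-1 * \sum_(i < n) q i)
    (d' : measure_display) (T' : measurableType d') (P' : probability T' R)
    (B : {RV P' >-> nat}) (lawB : has_binomial_law P' B n p)
    (t : R) (t01 : 0 < t < 1 - p) :
  (P [set w | (n%:R * t <= \sum_(i < n) Y i w)%R]
    <= inf_increasing_convex P' B (n%:R * t + n%:R * p))%E
  /\
  (n%:R * (p + t) \is a Num.int -> 0 < n%:R * (p + t) ->
   p * (1 - p) * (expR 1 - 1) / (1 - p + expR 1 * p) < t < 1 - p ->
   exists h : R,
     [/\ unique (optimal_exponent P' B n p t) h,
         (inf_increasing_convex P' B (n%:R * t + n%:R * p)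
           <= (improved_bound P' B n p t h)%:E)%E &
         improved_bound P' B n p t h < H_m n p t]).
Proof.
have n0 : 0 < n%:R :> R by rewrite ltr0n.
have qp : \sum_(i < n) q i = n%:R * p by rewrite pE mulVKf// gt_eqF.
have p0 : 0 < p.
  rewrite pE mulr_gt0 ?invr_gt0// (bigD1 (Ordinal n_gt0))//=.
  apply: ltr_pwDl; first by case/andP: (q01 (Ordinal n_gt0)).
  by apply: sumr_ge0 => i _; case/andP: (q01 i) => /ltW.
have p01 : 0 < p < 1 by lra.
have p01' : 0 <= p <= 1 by lra.
have q01' i : 0 <= q i <= 1 by have := q01 i; lra.
split.
  apply: le_ereal_inf_tmp => _ [f [cf fx] <-].
  have [f0 _ _] := cf.
  rewrite lee_pdivlMl// (binomial_expectation_iter P' B n p)//.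
  exact: martingale_tail_le.
move=> /intrP[z zE] z0 ht.
have at01 : 0 < p + t < 1 by lra.
have [m mE] : exists m : nat, n%:R * (p + t) = m%:R.
  case: z zE => m zE; first by exists m.
  by move: z0; rewrite zE ltr0z.
have mn : (m < n)%N.
  by rewrite -(ltr_nat R) -mE gtr_pMr//; case/andP: at01.
have h1 : 1 < chernoff_exponent p (p + t).
  by apply: chernoff_exponent_gt1 => //; case/andP: ht.
have h0 : 0 < chernoff_exponent p (p + t) by lra.
exists (chernoff_exponent p (p + t)); split.
- exact: unique_optimal_exponent.
- rewrite -mulrDr [t + p]addrC mE.
  by apply: (inf_increasing_convex_le_improved_bound P' B n m p t) => //; exact: ltnW.
- exact: (improved_bound_lt_H_m P' B n m p t).
Qed.
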